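(* For integers $n$ and $f$ with $f\ge 2$ and $n\ge f+1$, let $D(n,f)$ be the minimum possible diameter of a tree of order $n$ with exactly $f$ leaves. Then for every positive integer $k$, $$ D(n,f)=\begin{cases} 2 & \text{if } n=f+1;\\ 2k+1 & \text{if } n=kf+2;\\ 2k+2 & \text{if } kf+3\le n\le (k+1)f+1.\end{cases} $$
   Context: A leaf of a graph is a vertex of degree $1$. The order of a tree is its number of vertices; its diameter is the maximum distance between two vertices. Every tree with at least two vertices has at least two leaves. *)

(* Defs.v *)
From mathcomp Require Import all_boot.

Set Implicit Arguments.
Unset Strict Implicit.
Unset Printing Implicit Defensive.

Record sgraph (T : finType) := SGraph {
  adj :> rel T;
  adj_sym : symmetric adj;
  adj_irr : irreflexive adj }.

Section SimpleGraph.
Variables (T : finType) (G : sgraph T).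

Definition degree (x : T) : nat := #|[set y | adj G x y]|.

Definition leaves : {set T} := [set x | degree x == 1].

(* There is a walk with exactly k edges from x to y. *)
Definition walk (x y : T) (k : nat) : bool :=
  [exists p : k.-tuple T, path (adj G) x p && (last x p == y)].

(* Length of a shortest path from x to y. A shortest path has fewer than #|T|
   edges, so the search range suffices; the value is #|T| if x and y are
   disconnected, which does not occur in a tree. *)
Definition dist (x y : T) : nat := find (walk x y) (iota 0 #|T|).

Definition diameter : nat := \max_(x : T) \max_(y : T) dist x y.

Definition connected : Prop := forall x y : T, connect (adj G) x y.

(* ucycle also holds of the empty sequence and of [:: x; y] for an edge xy,
   hence the bound on the size. *)
Definition acyclic : Prop := forall c : seq T, ucycle (adj G) c -> size c < 3.

Definition is_tree : Prop := [/\ 0 < #|T|, connected & acyclic].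

End SimpleGraph.

Definition tree_with (n f : nat) (T : finType) (G : sgraph T) : Prop :=
  [/\ is_tree G, #|T| = n & #|leaves G| = f].

(* D(n, f) = d. *)
Definition min_diameter (n f d : nat) : Prop :=
  (exists (T : finType) (G : sgraph T), tree_with n f G /\ diameter G = d) /\
  (forall (T : finType) (G : sgraph T), tree_with n f G -> d <= diameter G).

(* Main.v *)
Require Import Defs.
From mathcomp Require Import all_boot.
From mathcomp Require Import zify.

(** Lower bound: if the diameter is at most [2k] (resp. [2k+1]), then every
    vertex is within distance [k] of a vertex (resp. of one end of an edge) in
    the middle of a longest path.  Sort the vertices by their distance to that
    core.  A vertex outside the core has exactly one neighbour that is not
    further away, so by downward induction the level [j > 0] has at most as many
    vertices as there are leaves at level at least [j].  Hence the [k] levels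
    outside the core contain at most [k * f] vertices.

    Upper bound: the spider on [0, ..., n-1] in which [i > 0] is attached to
    [i - f], truncated at [0], has [f] legs whose lengths differ by at most one. *)

Set Implicit Arguments.
Unset Strict Implicit.
Unset Printing Implicit Defensive.

(** * Walks, distances and geodesics *)

Section Distance.
Variables (T : finType) (G : sgraph T).

Lemma walkP x y k :
  reflect (exists p, [/\ path G x p, last x p = y & size p = k]) (walk G x y k).
Proof.
apply: (iffP existsP) => [[p /andP[pp /eqP lp]]|[p [pp lp sp]]].
  by exists p; rewrite size_tuple.
move/eqP: sp => sp; exists (Tuple sp) => /=.
by rewrite pp lp eqxx.
Qed.

Lemma dist_le_card x y : dist G x y <= #|T|.
Proof. by have := find_size (walk G x y) (iota 0 #|T|); rewrite size_iota. Qed.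

Lemma dist_le_walk x y k : walk G x y k -> dist G x y <= k.
Proof.
move=> wk; rewrite /dist leqNgt; apply/negP => lt_k.
have lt_kT: k < #|T| := leq_trans lt_k (dist_le_card x y).
by have := before_find 0 lt_k; rewrite nth_iota // add0n wk.
Qed.

Lemma distxx x : dist G x x = 0.
Proof.
by apply/eqP; rewrite -leqn0; apply: dist_le_walk; apply/walkP; exists [::].
Qed.

Lemma dist_adj_le w z u : G w z -> dist G w u <= (dist G z u).+1.
Proof.
move=> wz; rewrite {2}/dist.
case: (boolP (has (walk G z u) (iota 0 #|T|))) => [hw|/hasNfind->]; last first.
  (* If the search from [z] fails, [dist G z u] is the default [#|T|], which bounds every
     distance. *)
  by rewrite size_iota leqW ?dist_le_card.
have := nth_find 0 hw; rewrite has_find size_iota in hw.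
rewrite nth_iota // add0n => /walkP[p [pp lp sp]].
apply: dist_le_walk; apply/walkP; exists (z :: p); split=> //=; last by rewrite sp.
by rewrite wz.
Qed.

Lemma dist_le_diameter x y : dist G x y <= diameter G.
Proof.
apply: leq_trans (leq_bigmax (F := fun x => \max_y dist G x y) x).
exact: (leq_bigmax (F := dist G x)).
Qed.

Lemma diameter_leP d : (forall x y, dist G x y <= d) -> diameter G <= d.
Proof. by move=> le_d; apply/bigmax_leqP => x _; apply/bigmax_leqP. Qed.

Lemma diameter_attained : 0 < #|T| -> exists x y, dist G x y = diameter G.
Proof.
move=> T0; rewrite /diameter; have [x ->] := eq_bigmax (fun x => \max_y dist G x y) T0.
by have [y ->] := eq_bigmax (dist G x) T0; exists x, y.
Qed.

Section Connected.
Hypothesis conG : connected G.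

Lemma walk_dist x y : walk G x y (dist G x y).
Proof.
have hw: has (walk G x y) (iota 0 #|T|).
  (* A duplicate-free path has fewer than [#|T|] edges, so its length lies in the search range. *)
  have /connectP[p0 pp0 ->] := conG x y.
  case: (shortenP pp0) => p pp up _.
  apply/hasP; exists (size p); last by apply/walkP; exists p.
  by rewrite mem_iota add0n; have := max_card (mem (x :: p)); rewrite (card_uniqP up).
have := nth_find 0 hw; rewrite has_find size_iota in hw.
by rewrite nth_iota.
Qed.

Lemma dist_eq0 x y : dist G x y = 0 -> x = y.
Proof. by move=> d0; have := walk_dist x y; rewrite d0 => /walkP[[|a p] []]. Qed.

Lemma dist_triangle y x z : dist G x z <= dist G x y + dist G y z.
Proof.
have /walkP[p [pp lp <-]] := walk_dist x y.
have /walkP[q [pq lq <-]] := walk_dist y z.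
apply: dist_le_walk; apply/walkP; exists (p ++ q).
by rewrite cat_path last_cat lp size_cat pp.
Qed.

Lemma distC x y : dist G x y = dist G y x.
Proof.
suff le x' y' : dist G x' y' <= dist G y' x' by apply/eqP; rewrite eqn_leq !le.
have /walkP[p [pp lp sp]] := walk_dist y' x'; rewrite -sp.
apply: dist_le_walk; apply/walkP; exists (rev (belast y' p)).
rewrite size_rev size_belast -lp rev_path; split=> //.
  by under eq_path => a b do rewrite adj_sym.
case: p {pp lp sp} => //= a p.
by rewrite rev_cons last_rcons.
Qed.

Lemma dist_step w u m : dist G w u = m.+1 -> exists2 z, G w z & dist G z u = m.
Proof.
move=> dm; have := walk_dist w u; rewrite dm => /walkP[[|z p] /= []] //.
case/andP=> wz pp lp [sp]; exists z => //.
have: dist G z u <= m by apply: dist_le_walk; apply/walkP; exists p.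
by have := dist_adj_le u wz; lia.
Qed.

Lemma geodesic_point x y i : i <= dist G x y ->
  exists c, dist G x c = i /\ dist G c y = dist G x y - i.
Proof.
elim: i => [|i IH] lt_i; first by exists x; rewrite distxx subn0.
have [c [xc cy]] := IH (ltnW lt_i).
have [z cz zy] := @dist_step c y (dist G x y - i.+1) ltac:(lia).
exists z; split=> //.
(* The triangle inequality gives [i.+1 <= dist G x z]; the edge from [c] to [z] gives the reverse
   bound. *)
have := dist_triangle z x y; have := dist_adj_le x (etrans (adj_sym G z c) cz).
rewrite !(distC _ x); lia.
Qed.

End Connected.

(** * Deleting a vertex of a tree *)

Definition avoid (c : T) : rel T := [rel x y | [&& G x y, x != c & y != c]].

Lemma avoid_connect_sym c : connect_sym (avoid c).
Proof.
by apply: sym_connect_sym => x y; rewrite /avoid /= adj_sym [(x != c) && _]andbC.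
Qed.

Section Tree.
Hypotheses (conG : connected G) (acyG : acyclic G).

(** For [y != z], a path from [y] to [z] that misses [w] would close up through [w] to a cycle of
    length at least 3. *)
Lemma avoid_neighbours_eq w y z :
  G w y -> G w z -> connect (avoid w) y z -> y = z.
Proof.
move=> wy wz /connectP[p0 pp0 def_z]; move: wz; rewrite {}def_z.
case: (shortenP pp0) => p pp up _ wz.
have pG: path G y p by apply: sub_path pp => a b /and3P[].
have nw: w \notin p.
  elim: p y pp {pG up wy wz pp0} => //= a p IH y /andP[/and3P[_ _ aw] /IH np].
  by rewrite inE negb_or eq_sym aw.
case: p => // a p in pp up wz pG nw *.
suff: size [:: w, y, a & p] < 3 by [].
apply: acyG; apply/andP; split.
  rewrite /cycle rcons_path -[path _ _ _]/(G w y && path G y (a :: p)).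
  by rewrite wy [path _ _ _]pG /= adj_sym.
rewrite cons_uniq up andbT inE negb_or nw andbT.
by apply: contraTneq wy => ->; rewrite adj_irr.
Qed.

(** Later vertices of a geodesic from [y] to [u] are closer to [u] than [y], hence than [w], so none
    of them is [w]. *)
Lemma avoid_geodesic w y u :
  y != w -> dist G y u <= dist G w u -> connect (avoid w) y u.
Proof.
move dm: (dist G y u) => m; elim: m y dm => [|m IH] y dm yw le_m.
  by rewrite (dist_eq0 conG dm).
have [z yz dz] := dist_step conG dm.
have zw: z != w by apply: contraTneq le_m => <-; rewrite dz ltnn.
apply: connect_trans (IH z dz zw (ltnW le_m)); apply: connect1.
by rewrite /avoid /= yz yw.
Qed.

(** Trees are bipartite: with equal distances, [v] and the next vertex [z] on a geodesic from [u]
    would be joined outside [u], which forces [z = v]. *)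
Lemma dist_adj_neq u v w : G u v -> dist G u w <> dist G v w.
Proof.
move=> uv; move dm: (dist G u w) => [|m] dv.
  by move: uv; rewrite (dist_eq0 conG dm) (dist_eq0 conG (esym dv)) adj_irr.
have [z uz dz] := dist_step conG dm.
have zu: z != u by apply: contraTneq uz => ->; rewrite adj_irr.
have vu: v != u by apply: contraTneq uv => ->; rewrite adj_irr.
have zv: z = v.
  apply: avoid_neighbours_eq uz uv _.
  apply: (connect_trans (y := w)); first by apply: avoid_geodesic => //; lia.
  by rewrite avoid_connect_sym; apply: avoid_geodesic => //; lia.
by move: dz; rewrite zv; lia.
Qed.

(** Every geodesic from [v] to [a] has to pass through [c]; the induction follows one until it gets
    there. *)
Lemma dist_cut c v a :
  ~~ connect (avoid c) v a -> dist G v c + dist G c a <= dist G v a.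
Proof.
move dm: (dist G v a) => m; elim: m v dm => [|m IH] v dm ncon.
  by rewrite (dist_eq0 conG dm) connect0 in ncon.
case: (eqVneq v c) dm ncon => [-> | vc] dm ncon; first by rewrite distxx dm.
have [z vz dz] := dist_step conG dm.
have := dist_adj_le c vz.
have [zc | zc] := eqVneq z c; first by rewrite -zc distxx dz; lia.
have: ~~ connect (avoid c) z a.
  apply: contra ncon; apply: connect_trans; apply: connect1.
  by rewrite /avoid /= vz vc.
by move/(IH z dz); lia.
Qed.

(* Outside [c], a vertex cannot be joined to both ends of a path through [c]. *)
Lemma dist_between a b c v : dist G a c + dist G c b = dist G a b ->
  dist G v c + dist G c a <= dist G v a \/ dist G v c + dist G c b <= dist G v b.
Proof.
move=> abc.
case: (boolP (connect (avoid c) v a)) => [va|/dist_cut]; last by left.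
case: (boolP (connect (avoid c) v b)) => [vb|/dist_cut]; last by right.
have ab: connect (avoid c) a b.
  by apply: connect_trans vb; rewrite avoid_connect_sym.
move da: (dist G c a) => [|m].
  by left; rewrite (dist_eq0 conG da) addn0.
move db: (dist G c b) => [|l].
  by right; rewrite (dist_eq0 conG db) addn0.
(* Since [a] and [b] are joined outside [c], the first steps from [c] towards [a] and towards [b]
   coincide, and skipping [c] shortens the geodesic from [a] to [b] by 2. *)
have [y cy dy] := dist_step conG da.
have [z cz dz] := dist_step conG db.
have yc: y != c by apply: contraTneq cy => ->; rewrite adj_irr.
have zc: z != c by apply: contraTneq cz => ->; rewrite adj_irr.
have yz: y = z.
  apply: avoid_neighbours_eq cy cz _.
  apply: (connect_trans (y := a)); first by apply: avoid_geodesic => //; lia.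
  apply: (connect_trans ab).
  by rewrite avoid_connect_sym; apply: avoid_geodesic => //; lia.
have := dist_triangle conG y a b.
by rewrite (distC conG a y) dy yz dz -abc (distC conG a c) da db; lia.
Qed.

(** [c] halves a diametral path from [a] to [b]. By [dist_between], [w] reaches [a] or [b] through
    [c], which leaves at most [k] for the distance to [c]. *)
Lemma center_exists k : 0 < #|T| -> diameter G <= k.*2 ->
  exists c, forall w, dist G w c <= k.
Proof.
move=> T0 dk; have [a [b ab]] := diameter_attained T0.
have [c [ac cb]] := @geodesic_point conG a b (diameter G)./2 ltac:(lia).
exists c => w.
have := @dist_between a b c w ltac:(lia); rewrite (distC conG c a).
have := dist_le_diameter w a; have := dist_le_diameter w b; lia.
Qed.

(** [u] and [v] are the middle vertices of a diametral path. By [dist_between] both are within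
    [k + 1] of [w], and by [dist_adj_neq] not both at distance [k + 1]. *)
Lemma central_edge_exists k : 0 < #|T| -> diameter G = k.*2.+1 ->
  exists u v, G u v /\ forall w, minn (dist G w u) (dist G w v) <= k.
Proof.
move=> T0 dk; have [a [b ab]] := diameter_attained T0.
have [u [au ub]] := @geodesic_point conG a b k ltac:(lia).
have [v uv vb] := @dist_step conG u b k ltac:(lia).
have av: dist G a v = k.+1.
  have := dist_triangle conG v a b.
  have := dist_adj_le a (etrans (adj_sym G v u) uv); rewrite !(distC conG _ a); lia.
exists u, v; split=> // w.
have := @dist_between a b u w ltac:(lia); rewrite (distC conG u a).
have := @dist_between a b v w ltac:(lia); rewrite (distC conG v a).
have := dist_le_diameter w a; have := dist_le_diameter w b.
have := @dist_adj_neq u v w uv; rewrite !(distC conG _ w); lia.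
Qed.

(** * Counting vertices level by level *)

Section Levels.
(** [h] stands for the distance to the core, so that one argument serves a central vertex and a
    central edge. *)
Variable h : T -> nat.
Hypothesis h_down : forall w m, h w = m.+1 -> exists2 z, G w z & h z = m.
Hypothesis h_adj : forall w y, G w y -> h y <= (h w).+1.
Hypothesis h_uniq : forall w y z, 0 < h w ->
  G w y -> G w z -> h y <= h w -> h z <= h w -> y = z.

Let par y := odflt y [pick z | G y z && (h z < h y)].

(** Only one neighbour of [w] is not further out. A non-leaf has another one, which lies one level
    up and has [w] as its only lower neighbour. *)
Lemma nonleaf_parent w : 0 < h w -> w \notin leaves G ->
  exists2 y, h y = (h w).+1 & par y = w.
Proof.
move=> h0; rewrite inE => deg1.
have [z wz hz] := @h_down w (h w).-1 ltac:(lia).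
have /subsetPn[y]: ~~ ([set y | G w y] \subset [set z]).
  apply: contra deg1 => sub; rewrite /degree.
  have ->: [set y | G w y] = [set z]; last by rewrite cards1.
  by apply/eqP; rewrite eqEsubset sub sub1set inE.
rewrite !inE => wy yz.
have hy: h w < h y.
  rewrite ltnNge; apply: contra yz => le; apply/eqP.
  by apply: h_uniq wy wz le _ => //; lia.
have yw: G y w by rewrite adj_sym.
exists y; first by have := h_adj wy; lia.
rewrite /par; case: pickP => [x /andP[yx hx]|/(_ w)]; last by rewrite yw hy.
by apply: h_uniq yx yw _ _ => //; lia.
Qed.

Lemma level_card r j : (forall w, h w <= r) -> 0 < j ->
  #|[set w | h w == j]| <= #|[set w in leaves G | j <= h w]|.
Proof.
(* Downward induction on [j]: [m] bounds the number of levels left, and there is no vertex past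
   level [r]. *)
move=> h_le; have [m] : exists m, r < j + m by exists r.+1; lia.
elim: m j => [|m IH] j lt_r j0.
  rewrite (_ : [set w | h w == j] = set0) ?cards0 //.
  by apply/setP => w; rewrite !inE; have := h_le w; lia.
have {}IH := IH j.+1 ltac:(lia) isT.
(* Leaves of level [j] count themselves; the other vertices of level [j] are charged to level
   [j.+1], hence to leaves further out. *)
rewrite -(cardsID (leaves G) [set w | h w == j]).
rewrite -(cardsID [set w | h w == j] [set w in leaves G | j <= h w]).
apply: leq_add.
  by apply/subset_leq_card/subsetP => w; rewrite !inE => /andP[/eqP-> ->]; rewrite leqnn eqxx.
have sub: [set w | h w == j] :\: leaves G \subset par @: [set w | h w == j.+1].
  apply/subsetP => w; rewrite !inE => /andP[nl /eqP hj].
  have [||y hy py] := @nonleaf_parent w; [by lia|by rewrite inE|].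
  by apply/imsetP; exists y; rewrite ?inE ?hy ?hj.
apply: leq_trans (subset_leq_card sub) _.
apply: leq_trans (leq_imset_card _ _) _.
apply: leq_trans IH _; apply/subset_leq_card/subsetP => w.
by rewrite !inE => /andP[-> lt]; lia.
Qed.

Lemma card_le_levels r : (forall w, h w <= r) ->
  #|T| <= #|[set w | h w == 0]| + r * #|leaves G|.
Proof.
move=> h_le.
suff le m : #|[set w | h w <= m]| <= #|[set w | h w == 0]| + m * #|leaves G|.
  apply: leq_trans (le r); rewrite -cardsT; apply/subset_leq_card/subsetP => w _.
  by rewrite inE.
elim: m => [|m IH].
  by rewrite mul0n addn0; apply/subset_leq_card/subsetP => w; rewrite !inE leqn0.
have lev: #|[set w | h w == m.+1]| <= #|leaves G|.
  apply: leq_trans (level_card h_le _) _ => //.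
  by apply/subset_leq_card/subsetP => w; rewrite inE => /andP[].
rewrite mulSn addnCA addnC; apply: leq_trans (leq_add IH lev).
apply: leq_trans (leq_card_setU _ _); apply/subset_leq_card/subsetP => w.
by rewrite !inE; lia.
Qed.

End Levels.

(** Allowing [u = v] covers both kinds of core. For [w] outside it, all neighbours not further away
    are joined to [u] once [w] is deleted, so they coincide. *)
Lemma card_le_core r u v : (u == v) || G u v ->
  (forall w, minn (dist G w u) (dist G w v) <= r) ->
  #|T| <= #|[set u; v]| + r * #|leaves G|.
Proof.
move=> uv; set h := fun w => minn (dist G w u) (dist G w v) => h_le.
apply: leq_trans (card_le_levels (h := h) _ _ _ h_le) _.
- move=> w m hw.
  have [le|lt] := leqP (dist G w u) (dist G w v).
    have [z wz dz] := @dist_step conG w u m ltac:(rewrite -hw /h; lia).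
    exists z => //; have := dist_adj_le v wz; move: hw; rewrite /h; lia.
  have [z wz dz] := @dist_step conG w v m ltac:(rewrite -hw /h; lia).
  exists z => //; have := dist_adj_le u wz; move: hw; rewrite /h; lia.
- move=> w y; rewrite adj_sym => wy.
  by have := dist_adj_le u wy; have := dist_adj_le v wy; rewrite /h; lia.
- move=> w y z h0 wy wz hy hz.
  have uw: u != w by apply: contraTneq h0 => <-; rewrite /h distxx min0n.
  have vw: v != w by apply: contraTneq h0 => <-; rewrite /h distxx minn0.
  have cuv: connect (avoid w) u v.
    have /orP[/eqP->|adj_uv] := uv; first exact: connect0.
    by apply: connect1; rewrite /avoid /= adj_uv uw.
  have to_u x: G w x -> h x <= h w -> connect (avoid w) x u.
    move=> wx hx; have xw: x != w by apply: contraTneq wx => ->; rewrite adj_irr.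
    have [le|lt] := leqP (dist G x u) (dist G x v).
      by apply: avoid_geodesic => //; move: hx; rewrite /h; lia.
    apply: (connect_trans (y := v)); last by rewrite avoid_connect_sym.
    by apply: avoid_geodesic => //; move: hx; rewrite /h; lia.
  apply: (avoid_neighbours_eq wy wz).
  by apply: connect_trans (to_u y wy hy) _; rewrite avoid_connect_sym; apply: to_u.
rewrite leq_add2r; apply/subset_leq_card/subsetP => w; rewrite !inE /h => /eqP h0.
have [] : dist G w u = 0 \/ dist G w v = 0 by lia.
  by move/(dist_eq0 conG)->; rewrite eqxx.
by move/(dist_eq0 conG)->; rewrite eqxx orbT.
Qed.

End Tree.

(** * Bounding the order by the diameter and the leaves *)

Lemma tree_card_even k : is_tree G -> diameter G <= k.*2 ->
  #|T| <= k * #|leaves G| + 1.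
Proof.
case=> T0 conG acyG dk; have [c hc] := center_exists conG acyG T0 dk.
have := @card_le_core conG acyG k c c; rewrite eqxx setUid cards1 addnC.
by apply=> // w; rewrite minnn.
Qed.

Lemma tree_card_odd k : is_tree G -> diameter G <= k.*2.+1 ->
  #|T| <= k * #|leaves G| + 2.
Proof.
move=> treeG; rewrite leq_eqVlt => /orP[/eqP dk|/(tree_card_even treeG)]; last by lia.
case: treeG => T0 conG acyG.
have [u [v [uv huv]]] := central_edge_exists conG acyG T0 dk.
have := @card_le_core conG acyG k u v; rewrite uv orbT addnC cards2.
by move=> /(_ isT huv); lia.
Qed.

End Distance.

(** * The balanced spider *)

Section Spider.
Variables (m f : nat).
Hypotheses (f_ge2 : 2 <= f) (f_le : f <= m).

(** Truncated subtraction attaches [1, ..., f] to [0]; the inequality removes the loop at [0]. *)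
Definition spider_rel : rel 'I_m.+1 :=
  fun x y => (x != y :> nat) && ((x - f == y) || (y - f == x)).

Lemma spider_sym : symmetric spider_rel.
Proof. by move=> x y; rewrite /spider_rel eq_sym orbC. Qed.

Lemma spider_irr : irreflexive spider_rel.
Proof. by move=> x; rewrite /spider_rel eqxx. Qed.

Definition spider := SGraph spider_sym spider_irr.

Lemma spiderE (x y : 'I_m.+1) :
  spider x y = (x != y :> nat) && ((x - f == y) || (y - f == x)).
Proof. by []. Qed.

(** Each step towards the root subtracts [f], so the multiples of [f] delimit the depths. *)
Lemma spider_root_walk d (x : 'I_m.+1) : x <= d * f ->
  exists2 e, e <= d & walk spider x ord0 e.
Proof.
elim: d x => [|d IH] x lex.
  exists 0 => //; apply/walkP; exists [::]; split=> //=.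
  by apply: val_inj => /=; lia.
have [x0|x0] := posnP x.
  by exists 0 => //; apply/walkP; exists [::]; split=> //=; apply: val_inj.
have lt_y: x - f < m.+1 by have := ltn_ord x; lia.
have [|e le_e /walkP[p [pp lp sp]]] := IH (Ordinal lt_y).
  by rewrite /=; move: lex; rewrite mulSn; lia.
exists e.+1 => //; apply/walkP; exists (Ordinal lt_y :: p); split=> //=; last by rewrite sp.
by rewrite pp andbT /spider_rel /= eqxx andbT; lia.
Qed.

Lemma spider_connected : connected spider.
Proof.
suff to0 x: connect spider x ord0.
  move=> x y; apply: (connect_trans (to0 x)).
  by rewrite (sym_connect_sym spider_sym).
have [|e _ /walkP[p [pp lp _]]] := @spider_root_walk x x; first by rewrite leq_pmulr; lia.
by apply/connectP; exists p.
Qed.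

Lemma spider_dist d e (x y : 'I_m.+1) : x <= d * f -> y <= e * f ->
  dist spider x y <= d + e.
Proof.
move=> hx hy.
have [i le_i /dist_le_walk wi] := spider_root_walk hx.
have [j le_j /dist_le_walk wj] := spider_root_walk hy.
have := dist_triangle spider_connected ord0 x y.
rewrite (distC spider_connected ord0 y); lia.
Qed.

(* The two cycle neighbours of the largest vertex [x] of a cycle would both be
   equal to [x - f]. *)
Lemma spider_acyclic : acyclic spider.
Proof.
move=> c /andP[cyc uc]; rewrite ltnNge; apply/negP => sz.
have [x0 x0c] : exists x0, x0 \in c by case: c sz {cyc uc} => // x c _; exists x; rewrite inE eqxx.
case: (@arg_maxnP _ x0 (fun x => x \in c) (fun x => val x) x0c) => x xc xmax.
(* Once the cycle is rotated to start at [x], the neighbours of [x] on it are the first and last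
   entries of [p], distinct because [p] has at least two entries. *)
have [i p def_p] := rot_to xc.
have := cyc; rewrite -(rot_cycle i) def_p.
have := uc; rewrite -(rot_uniq i) def_p.
have memp y : y \in p -> y <= x.
  by move=> yp; apply: xmax; rewrite -(mem_rot i) def_p inE yp orbT.
have: 2 <= size p by rewrite -ltnS -[(size p).+1]/(size (x :: p)) -def_p size_rot.
case: p memp {def_p} => // y p; case/lastP: p => // p z memp _ /=.
rewrite !rcons_path !last_rcons => /and3P[_ yp _] /and3P[xy _ zx].
have yz : y != z by apply: contraNneq yp => ->; rewrite mem_rcons inE eqxx.
have := memp y; have := memp z; rewrite !inE !mem_rcons !inE !eqxx !orbT => /(_ isT) + /(_ isT).
by move: xy zx yz; rewrite /spider_rel -!val_eqE /=; lia.
Qed.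

Lemma spider_tree : is_tree spider.
Proof.
by split; [rewrite card_ord|exact: spider_connected|exact: spider_acyclic].
Qed.

Lemma spider_leafE (x : 'I_m.+1) : (x \in leaves spider) = (m < x + f).
Proof.
rewrite inE /degree; apply/idP/idP => [/cards1P[y defy]|lt].
  rewrite ltnNge; apply/negP => le_m.
  have lt_z: x + f < m.+1 by [].
  have zy: Ordinal lt_z = y.
    by apply/set1P; rewrite -defy inE spiderE /=; lia.
  (* The root has the distinct neighbours [1] and [f]; any other [x] here has [x - f] and
     [x + f]. *)
  have [x0|x0] := posnP x.
    have lt1: 1 < m.+1 by lia.
    have: Ordinal lt1 = y by apply/set1P; rewrite -defy inE spiderE /=; lia.
    by rewrite -zy => /(congr1 val) /=; lia.
  have lt_w: x - f < m.+1 by have := ltn_ord x; lia.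
  have: Ordinal lt_w = y by apply/set1P; rewrite -defy inE spiderE /=; lia.
  by rewrite -zy => /(congr1 val) /=; lia.
have lt_w: x - f < m.+1 by have := ltn_ord x; lia.
apply/cards1P; exists (Ordinal lt_w); apply/setP => y.
rewrite !inE spiderE -val_eqE /=; have := ltn_ord y; lia.
Qed.

Lemma spider_leaves : #|leaves spider| = f.
Proof.
have cardC : #|~: leaves spider| = m.+1 - f.
  have le : m.+1 - f <= m.+1 by exact: leq_subr.
  (* The non-leaves form the initial segment [x <= m - f]. *)
  have ->: ~: leaves spider = [set widen_ord le i | i in [set: 'I_(m.+1 - f)]].
    apply/setP => x; rewrite inE spider_leafE; apply/idP/imsetP => [nlt|[i _ ->]].
      have lt_x: x < m.+1 - f by lia.
      by exists (Ordinal lt_x) => //; apply: val_inj.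
    by have := ltn_ord i; rewrite /=; lia.
  rewrite card_imset ?cardsT ?card_ord // => i j /(congr1 val) /= ij.
  exact: val_inj.
have := cardsC (leaves spider); rewrite cardC card_ord; lia.
Qed.

Lemma spider_tree_with : tree_with m.+1 f spider.
Proof. by split; [exact: spider_tree|rewrite card_ord|exact: spider_leaves]. Qed.

End Spider.

(** * The three values of the minimum diameter *)

Lemma min_diameter_spider m f d (f2 : 2 <= f) (fm : f <= m) :
    diameter (spider m f) <= d ->
    (forall (T : finType) (G : sgraph T), tree_with m.+1 f G -> d <= diameter G) ->
  min_diameter m.+1 f d.
Proof.
move=> le_d ge_d; split=> //.
have tw := spider_tree_with f2 fm; exists 'I_m.+1, (spider m f); split=> //.
by apply/eqP; rewrite eqn_leq le_d ge_d.
Qed.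

Theorem theorem3 (n f : nat) (hf : 2 <= f) (hn : f + 1 <= n)
    (k : nat) (hk : 0 < k) :
  [/\ n = f + 1 -> min_diameter n f 2,
      n = k * f + 2 -> min_diameter n f (2 * k + 1)
    & k * f + 3 <= n <= (k + 1) * f + 1 -> min_diameter n f (2 * k + 2)].
Proof.
case: n hn => [|m] hn; first by lia.
have fm: f <= m by lia.
split=> nE; apply: min_diameter_spider => //.
- apply: diameter_leP => x y.
  have xm := ltn_ord x; have ym := ltn_ord y.
  by have := @spider_dist m f hf fm 1 1 x y; lia.
- move=> T G [treeG cT cL]; rewrite ltnNge; apply/negP => le.
  (* The odd bound at [0]: diameter at most 1 allows only two vertices, while [f + 1] is at least
     3. *)
  by have := @tree_card_odd T G 0 treeG le; lia.
- apply: diameter_leP => x y.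
  have xm := ltn_ord x; have ym := ltn_ord y.
  (* Only the vertex [k * f + 1] has depth [k + 1], so one of two distinct vertices has depth at
     most [k]. *)
  have [->|xy] := eqVneq x y; first by rewrite distxx.
  have {}xy: x <> y :> nat by move=> /val_inj/eqP; rewrite (negbTE xy).
  have [xk|xk] := leqP x (k * f).
    by have := @spider_dist m f hf fm k k.+1 x y; rewrite mulSn; lia.
  by have := @spider_dist m f hf fm k.+1 k x y; rewrite mulSn; lia.
- move=> T G [treeG cT cL]; rewrite addn1 ltnNge mul2n; apply/negP => le.
  by have := tree_card_even treeG le; rewrite cL; lia.
- apply: diameter_leP => x y.
  have xm := ltn_ord x; have ym := ltn_ord y.
  by have := @spider_dist m f hf fm (k + 1) (k + 1) x y; lia.
- move=> T G [treeG cT cL]; rewrite addn2 ltnNge mul2n; apply/negP => le.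
  by have := tree_card_odd treeG le; rewrite cL; lia.
Qed.
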